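(* Let $\mathbb{K}$ be a field, $s,b\ge1$ integers, and $Z=\mathbb{K}[z_{i,j}:1\le i\le s,\ 1\le j\le b]$. If $J$ is a sparse symmetric shifted ideal in $Z$, then $J$ has linear quotients.
   Context: For $\boldsymbol\mu=(\mu_1,\dots,\mu_s)\in\{0,1,\dots,b\}^s$ put $\boldsymbol z^{\boldsymbol\mu}=\prod_{i=1}^s z_{i,\mu_i}$, with the convention $z_{i,0}=1$; such a monomial is called a sparse squarefree monomial. For two such tuples, $\boldsymbol\mu'\le_0\boldsymbol\mu$ means: $\mu_i'\le\mu_i$ for each $i$, and $\mu_i'=0$ if and only if $\mu_i=0$. The permutation group $\mathfrak{S}_s$ acts on $Z$ by $\mathbb{K}$-algebra automorphisms with $\sigma(z_{i,j})=z_{\sigma(i),j}$. For a monomial ideal $J$, $G(J)$ denotes its set of minimal monomial generators. A squarefree monomial proper ideal $J$ of $Z$ is sparse symmetric shifted if: (S-1) $J$ is generated by sparse squarefree monomials; (S-2) whenever $\boldsymbol z^{\boldsymbol\mu}\in G(J)$ and $\boldsymbol\mu'\le_0\boldsymbol\mu$, then $\boldsymbol z^{\boldsymbol\mu'}\in J$; (S-3) $J$ is invariant under the action of $\mathfrak{S}_s$. A monomial ideal $J$ has linear quotients if its minimal monomial generators can be ordered $u_1,\dots,u_r$ so that for each $i=2,\dots,r$ the colon ideal $\langle u_1,\dots,u_{i-1}\rangle:u_i$ is generated by variables. *)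

(* Defs.v *)
From Stdlib Require Import Classical.
From mathcomp Require Import all_boot all_order all_algebra all_fingroup.
From mathcomp Require Import mpoly.

Set Implicit Arguments.
Unset Strict Implicit.
Unset Printing Implicit Defensive.

Import GRing.Theory.

Local Open Scope ring_scope.

Section Ideals.

Variable A : comNzRingType.
Implicit Types (I S : A -> Prop) (u p : A).

Definition is_ideal I : Prop :=
  I 0 /\ forall a u v : A, I u -> I v -> I (a * u + v).

Definition is_proper_ideal I : Prop := is_ideal I /\ ~ I 1.

Definition ideal_gen S p : Prop :=
  exists2 r : seq (A * A),
    forall x, x \in r -> S x.2 & p = \sum_(x <- r) x.1 * x.2.

Definition generates S I : Prop := forall p, I p <-> ideal_gen S p.

Definition generated_by (P : A -> Prop) I : Prop :=
  exists S : A -> Prop, (forall u, S u -> P u) /\ generates S I.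

Definition colon I u : A -> Prop := fun p => I (p * u).

Definition divides v u : Prop := exists w, u = w * v.

End Ideals.

Section MonomialIdeals.

Variables (K : fieldType) (n : nat).
Implicit Types (J : {mpoly K[n]} -> Prop) (u : {mpoly K[n]}).

Definition is_monomial u : Prop := exists m : 'X_{1..n}, u = 'X_[m].

Definition is_squarefree_monomial u : Prop :=
  exists m : 'X_{1..n}, (forall k : 'I_n, (m k <= 1)%N) /\ u = 'X_[m].

Definition is_variable u : Prop := exists k : 'I_n, u = 'X_k.

Definition is_monomial_ideal J : Prop :=
  is_ideal J /\ generated_by is_monomial J.

Definition is_squarefree_monomial_ideal J : Prop :=
  is_ideal J /\ generated_by is_squarefree_monomial J.

(* The set G(J): the monomials of J that are minimal for divisibility.  For a
   monomial ideal J this is the unique minimal set of monomial generators, see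
   [mingens_generates] and [mingens_least] below. *)
Definition mingens J u : Prop :=
  [/\ is_monomial u, J u &
      forall v, is_monomial v -> J v -> divides v u -> v = u].

(* The list is indexed from 0, so us`_0 is the first generator and the colon
   condition starts at index 1. *)
Definition has_linear_quotients J : Prop :=
  is_monomial_ideal J /\
  exists us : seq {mpoly K[n]},
    [/\ uniq us,
        forall u, u \in us <-> mingens J u &
        forall i : nat, (0 < i < size us)%N ->
          generated_by is_variable
            (colon (ideal_gen (fun v => v \in take i us)) us`_i)].

End MonomialIdeals.

Section MonomialIdealFacts.

Variables (K : fieldType) (n : nat).
Implicit Types (J S : {mpoly K[n]} -> Prop).

Lemma divides_monomial (m1 m2 : 'X_{1..n}) :
  divides ('X_[m1] : {mpoly K[n]}) 'X_[m2] <-> (m1 <= m2)%MM.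
Proof.
split=> [[w /(congr1 (mcoeff m2))]|le12].
  rewrite mcoeffX eqxx => /esym/eqP e.
  have: m2 \in msupp (w * 'X_[m1]) by rewrite mcoeff_msupp (eqP e) oner_eq0.
  by rewrite (perm_mem (msuppMX _ _)) => /mapP[m _ ->]; apply: lem_addr.
by exists 'X_[m2 - m1]; rewrite -mpolyXD submK.
Qed.

Lemma ideal_gen_monomial S (m : 'X_{1..n}) :
  (forall u, S u -> is_monomial u) -> ideal_gen S 'X_[m] ->
  exists2 m' : 'X_{1..n}, S 'X_[m'] & (m' <= m)%MM.
Proof.
move=> Smon [r rS /(congr1 (mcoeff m))]; rewrite mcoeffX eqxx raddf_sum /= => e.
have [/hasP[x xr xm]|/hasPn no] :=
    boolP (has (fun x : {mpoly K[n]} * {mpoly K[n]} => m \in msupp (x.1 * x.2)) r).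
  have [m' em'] := Smon _ (rS _ xr); exists m'; first by rewrite -em'; apply: rS.
  move: xm; rewrite em' (perm_mem (msuppMX _ _)) => /mapP[k _ ->].
  exact: lem_addr.
move: e; rewrite big_seq big1 => [|x /no]; last first.
  by rewrite mcoeff_msupp negbK => /eqP.
by move/eqP; rewrite oner_eq0.
Qed.

Lemma mingens_below J (m : 'X_{1..n}) :
  J 'X_[m] -> exists2 m' : 'X_{1..n}, mingens J 'X_[m'] & (m' <= m)%MM.
Proof.
have [d] := ubnP (mdeg m); elim: d m => // d IHd m le_md Jm.
have [[m' [Jm' le_m' ne_m']]|no] := classic
    (exists m' : 'X_{1..n}, [/\ J 'X_[m'], (m' <= m)%MM & m' <> m]).
  have dlt: (mdeg m' < mdeg m)%N.
    rewrite -(submK le_m') mdegD -[X in (X < _)%N]add0n ltn_add2r lt0n mdeg_eq0.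
    by apply/eqP => e; apply: ne_m'; rewrite -(submK le_m') e add0m.
  have [k mink le_k] := IHd m' (leq_trans dlt le_md) Jm'.
  by exists k => //; apply: lepm_trans le_k le_m'.
exists m; last exact: lepm_refl.
split=> [||_ [k ->] Jk /divides_monomial le_k] //; first by exists m.
by congr ('X_[_]); apply: NNPP => ne; apply: no; exists k.
Qed.

Lemma ideal_gen_sub (A : comNzRingType) (I S : A -> Prop) (p : A) :
  is_ideal I -> (forall u, S u -> I u) -> ideal_gen S p -> I p.
Proof.
move=> [I0 Iadd] SI [r rS ->]; elim: r rS => [|x r IHr] rS.
  by rewrite big_nil.
rewrite big_cons; apply: Iadd; first by apply/SI/rS/mem_head.
by apply: IHr => y yr; apply: rS; rewrite inE yr orbT.
Qed.

Lemma ideal_gen_ideal (A : comNzRingType) (S : A -> Prop) :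
  is_ideal (ideal_gen S).
Proof.
split; first by exists [::]; rewrite ?big_nil.
move=> a _ _ [r rS ->] [t tS ->].
exists ([seq (a * x.1, x.2) | x <- r] ++ t).
  by move=> x; rewrite mem_cat => /orP[/mapP[y yr ->]|/tS //]; apply: rS yr.
rewrite big_cat big_map mulr_sumr; congr (_ + _).
by apply: eq_bigr => x _; rewrite mulrA.
Qed.

Lemma mingens_generates J : is_monomial_ideal J -> generates (mingens J) J.
Proof.
move=> [idJ [S [Smon genS]]] p; split; last first.
  by apply: ideal_gen_sub => // u [].
move/genS; apply: ideal_gen_sub; first exact: ideal_gen_ideal.
move=> u Su; have [m em] := Smon _ Su.
have Ju: J 'X_[m].
  apply/genS; exists [:: (1, 'X_[m])]; last by rewrite big_seq1 mul1r.
  by move=> x; rewrite inE => /eqP -> /=; rewrite -em.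
have [k mink le_k] := mingens_below Ju.
exists [:: ('X_[m - k], 'X_[k])].
  by move=> x; rewrite inE => /eqP ->.
by rewrite big_seq1 /= -mpolyXD submK.
Qed.

Lemma mingens_least J S :
  (forall u, S u -> is_monomial u) -> generates S J ->
  forall u, mingens J u -> S u.
Proof.
move=> Smon genS _ [[m ->] Jm minm].
have [k Sk le_k] := ideal_gen_monomial Smon (proj1 (genS _) Jm).
rewrite -(minm 'X_[k]) //; first by exists k.
  apply/genS; exists [:: (1, 'X_[k])]; last by rewrite big_seq1 mul1r.
  by move=> x; rewrite inE => /eqP ->.
exact/divides_monomial.
Qed.

End MonomialIdealFacts.

Section SparseSymmetricShifted.

Variables (K : fieldType) (s b : nat).

(* Z = K[z_(i,j)], with the s * b variables numbered through [mxvec_index].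
   Both indices are shifted to start at 0: i : 'I_s and j : 'I_b. *)
Notation Z := {mpoly K[s * b]}.

Definition zvar (i : 'I_s) (j : 'I_b) : Z := 'X_(mxvec_index i j).

(* Exponent tuples take values in {0, ..., b}: the value 0 contributes the
   factor 1, and the value j.+1 the j-th variable of row i, that is z_(i,j.+1)
   in 1-based numbering. *)
Definition zvar0 (i : 'I_s) (j : 'I_b.+1) : Z :=
  if unlift ord0 j is Some j' then zvar i j' else 1.

Definition sparse_monomial (mu : {ffun 'I_s -> 'I_b.+1}) : Z :=
  \prod_(i < s) zvar0 i (mu i).

Definition is_sparse_squarefree (u : Z) : Prop :=
  exists mu : {ffun 'I_s -> 'I_b.+1}, u = sparse_monomial mu.

Definition le0 (mu' mu : {ffun 'I_s -> 'I_b.+1}) : Prop :=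
  forall i : 'I_s, (mu' i <= mu i)%N /\ (mu' i = ord0 <-> mu i = ord0).

(* Substitution z_(i,j) |-> z_(sigma i,j), see [sym_act_zvar]. *)
Definition sym_act (sigma : 'S_s) (p : Z) : Z :=
  p \mPo [tuple mxvec (\matrix_(i < s, j < b) zvar (sigma i) j) 0 k | k < s * b].

Lemma sym_act_zvar (sigma : 'S_s) (i : 'I_s) (j : 'I_b) :
  sym_act sigma (zvar i j) = zvar (sigma i) j.
Proof. by rewrite /sym_act comp_mpolyXU -tnth_nth tnth_mktuple mxvecE mxE. Qed.

Record sparse_symmetric_shifted (J : Z -> Prop) : Prop := {
  sss_proper : is_proper_ideal J;
  sss_squarefree : is_squarefree_monomial_ideal J;
  sss_S1 : generated_by is_sparse_squarefree J;
  sss_S2 : forall mu mu' : {ffun 'I_s -> 'I_b.+1},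
    mingens J (sparse_monomial mu) -> le0 mu' mu -> J (sparse_monomial mu');
  sss_S3 : forall (sigma : 'S_s) (p : Z), J p -> J (sym_act sigma p)
}.

End SparseSymmetricShifted.

(* Main.v *)
(** Identify a sparse monomial with its exponent tuple [mu].  Rank the variable
    [z_(i,v)] by [s * v + i], let the weight of a monomial be the sum of the ranks
    of its variables, and list the minimal generators by increasing weight.  Let
    [mu] and [nu] be distinct generators, [nu] not heavier than [mu].  Suppose that
    some variable [x = z_(i,v)] of [nu] has smaller rank than a variable [y] of
    [mu], where [y] is taken in row [i] if [mu] has a variable there.  By symmetry
    and shifting, replacing [y] by [x] in [mu] stays in [J]; a minimal generator
    dividing the result is lighter than [mu] and puts [x] in the colon ideal.
    If there is no such [x], then trading a variable of [nu] in a row free in [mu]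
    for a variable of [mu] in a row free in [nu] lowers the weight of [nu], stays in
    [J] and creates no such [x]; iterating these trades shows that [nu] is heavier
    than [mu], a contradiction. *)

Require Import Defs.
From mathcomp Require Import all_boot all_algebra all_fingroup.
From mathcomp Require Import boolp mpoly zify.

Set Implicit Arguments.
Unset Strict Implicit.
Unset Printing Implicit Defensive.

Import GRing.Theory.

Local Open Scope ring_scope.

Section Ideals.

Variable A : comNzRingType.
Implicit Types (I S : A -> Prop) (a u : A).

Lemma is_ideal_mull I a u : is_ideal I -> I u -> I (a * u).
Proof. by move=> [I0 Iadd] Iu; rewrite -[_ * _]addr0; apply: Iadd. Qed.

Lemma is_ideal_colon I u : is_ideal I -> is_ideal (colon I u).
Proof.
move=> [I0 Iadd]; split; first by rewrite /colon mul0r.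
by move=> a x y Ix Iy; rewrite /colon mulrDl -mulrA; apply: Iadd.
Qed.

Lemma mem_ideal_gen S u : S u -> ideal_gen S u.
Proof.
move=> Su; exists [:: (1, u)]; last by rewrite big_seq1 mul1r.
by move=> x; rewrite inE => /eqP ->.
Qed.

End Ideals.

Section MonomialsInIdeals.

Variable n : nat.
Implicit Types (m : 'X_{1..n}).

Lemma mpolyX_inj (R : nzRingType) : injective (fun m => 'X_[m] : {mpoly R[n]}).
Proof. exact: can_inj (@mleadXm n R). Qed.

Variable R : comNzRingType.
Implicit Types (I : {mpoly R[n]} -> Prop) (p : {mpoly R[n]}).

Lemma is_ideal_mpolyX_le I m m' :
  is_ideal I -> I 'X_[m] -> (m <= m')%MM -> I 'X_[m'].
Proof. by move=> idI Im /submK <-; rewrite mpolyXD; apply: is_ideal_mull. Qed.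

Lemma is_ideal_mpoly I p :
  is_ideal I -> (forall m, m \in msupp p -> I 'X_[m]) -> I p.
Proof.
move=> idI Im; rewrite (mpolyE p) big_seq.
elim/big_ind: _ => [|x y Ix Iy|m mp]; first by case: idI.
  by rewrite -[x]mul1r; apply: (proj2 idI).
by rewrite -mul_mpolyC; apply: is_ideal_mull (Im m mp).
Qed.

End MonomialsInIdeals.

Section MonomialIdeals.

Variables (K : fieldType) (n : nat).
Implicit Types (J S : {mpoly K[n]} -> Prop) (m : 'X_{1..n}) (p : {mpoly K[n]}).

Lemma ideal_gen_msupp S p m :
  (forall u, S u -> is_monomial u) -> ideal_gen S p -> m \in msupp p ->
  exists2 m', S 'X_[m'] & (m' <= m)%MM.
Proof.
move=> Smon Sp; move: p Sp m.
pose above p := forall m, m \in msupp p -> exists2 m', S 'X_[m'] & (m' <= m)%MM.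
suff above_ideal : is_ideal above.
  move=> p; apply: (ideal_gen_sub above_ideal) => u Su m.
  have [m' em'] := Smon u Su; rewrite em' msuppX inE => /eqP ->.
  by exists m'; rewrite -?em' ?lepm_refl.
split=> [m|a u v abv_u abv_v m]; first by rewrite msupp0.
move/msuppD_le; rewrite mem_cat => /orP[/msuppM_le|]; last exact: abv_v.
case/allpairsP=> -[m1 m2] /= [_ /abv_u[m' Sm' le_m'] ->].
by exists m' => //; apply: lepm_trans le_m' (lem_addl _ _).
Qed.

Lemma colon_generated_by_variables S m :
  (forall u, S u -> is_monomial u) ->
  (forall m', S 'X_[m'] -> exists k : 'I_n, (m k < m' k)%N /\
     exists2 w, S 'X_[w] & (w <= m + U_(k))%MM) ->
  generated_by (@is_variable K n) (colon (ideal_gen S) 'X_[m]).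
Proof.
move=> Smon exch; have idS : is_ideal (ideal_gen S) by apply: ideal_gen_ideal.
exists (fun u => is_variable u /\ colon (ideal_gen S) 'X_[m] u).
split=> [u [] //|p]; split; last first.
  by apply: ideal_gen_sub; [apply: is_ideal_colon | move=> u []].
move=> Ip; apply: is_ideal_mpoly => [|q qp]; first exact: ideal_gen_ideal.
have : (m + q)%MM \in msupp (p * 'X_[m]).
  by rewrite (perm_mem (msuppMX _ _)) (map_f (mnm_add m)).
move/(ideal_gen_msupp Smon Ip) => [m' /exch[k [lt_k [w Sw le_w]]] le_m'].
have le_kq : (U_(k) <= q)%MM.
  by rewrite lep1mP; have /mnm_lepP/(_ k) := le_m'; rewrite mnmDE; lia.
apply: is_ideal_mpolyX_le (ideal_gen_ideal _) _ le_kq; apply: mem_ideal_gen.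
split; first by exists k.
rewrite /colon -mpolyXD addmC.
exact: is_ideal_mpolyX_le idS (mem_ideal_gen Sw) le_w.
Qed.

Lemma has_linear_quotients_weight J (T : eqType) (gens : seq T)
    (mnm_of : T -> 'X_{1..n}) (weight : T -> nat) :
  is_monomial_ideal J -> injective mnm_of -> uniq gens ->
  (forall u, mingens J u <-> exists2 t, t \in gens & u = 'X_[mnm_of t]) ->
  {in gens &, forall t t', t' != t -> (weight t' <= weight t)%N ->
     exists k t'', [/\ t'' \in gens, (weight t'' < weight t)%N,
       (mnm_of t k < mnm_of t' k)%N & (mnm_of t'' <= mnm_of t + U_(k))%MM]} ->
  has_linear_quotients J.
Proof.
move=> monJ inj_mnm uniq_gens gensP exch; split=> //.
pose le_weight : rel T := relpre weight leq.
have tr_weight : transitive le_weight by move=> ? ? ?; apply: leq_trans.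
pose ts := sort le_weight gens; pose X t : {mpoly K[n]} := 'X_[mnm_of t].
have mem_ts : ts =i gens by move=> t; rewrite mem_sort.
have sorted_ts : sorted le_weight ts by apply: sort_sorted => ? ?; apply: leq_total.
have uniq_ts : uniq ts by rewrite sort_uniq.
exists (map X ts); split.
- by rewrite map_inj_uniq // => ? ? /mpolyX_inj/inj_mnm.
- move=> u; rewrite gensP; split=> [/mapP[t]|[t t_gens ->]].
    by rewrite mem_ts; exists t.
  by rewrite (map_f X) ?mem_ts.
move=> i /andP[_]; rewrite size_map => lt_i.
have t0 : T by case: (ts) lt_i.
rewrite (nth_map t0) // -map_take; set t := nth t0 ts i.
have t_ts : t \in ts by apply: mem_nth.
have before_t t' : t' \in ts -> (t' \in take i ts) = (index t' ts < index t ts)%N.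
  by move=> /in_take ->; rewrite index_uniq.
apply: colon_generated_by_variables => [u /mapP[t' _ ->]|m'].
  by exists (mnm_of t').
case/mapP=> t' t'_before /mpolyX_inj ->; have t'_ts := mem_take t'_before.
move: t'_before; rewrite before_t // => lt_t't.
have [||||k [t'' [t''_gens lt_w lt_k le_t'']]] := exch t t'; rewrite -?mem_ts //.
- by apply: contraTneq lt_t't => ->; rewrite ltnn.
- exact: (sorted_ltn_index tr_weight sorted_ts) lt_t't.
exists k; split=> //; exists (mnm_of t'') => //; apply: (map_f X).
rewrite before_t ?mem_ts // ltnNge; apply: contraTN lt_w => le_tt''.
rewrite -leqNgt -[(_ <= _)%N]/(le_weight t t'').
apply: (sorted_leq_index tr_weight) le_tt'' => // [?|]; first exact: leqnn.
by rewrite mem_ts.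
Qed.

End MonomialIdeals.

Section SparseTuples.

Variables (s b : nat).
Notation exps := {ffun 'I_s -> 'I_b.+1}.
Implicit Types (mu nu tau : exps) (i k : 'I_s).

Definition support mu : {set 'I_s} := [set i | 0 < mu i]%N.

Definition sparse_dvd tau mu : bool := [forall i in support tau, tau i == mu i].

Lemma leq_sparse_dvd tau mu i : sparse_dvd tau mu -> (tau i <= mu i)%N.
Proof.
move/forall_inP/(_ i); rewrite inE; case: posnP => [-> //|_].
by move/(_ isT)/eqP => ->.
Qed.

Lemma sparse_dvd_trans : transitive sparse_dvd.
Proof.
move=> mu tau nu dvd_tm /forall_inP dvd_mn; apply/forall_inP => i tau_i.
have /eqP e := forall_inP dvd_tm i tau_i.
by rewrite e dvd_mn // inE -e; rewrite inE in tau_i.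
Qed.

Lemma support_lift mu i : i \in support mu -> exists j, mu i = lift ord0 j.
Proof. by rewrite inE; case: (unliftP ord0 (mu i)) => [j -> _|-> //]; exists j. Qed.

Lemma le0P mu mu' : le0 mu' mu <-> forall i, ((0 < mu i) <= mu' i <= mu i)%N.
Proof.
split=> le_mu i; have := le_mu i.
  case=> le_i [mu'0 mu0]; rewrite le_i andbT; case: posnP => // mu_i.
  by rewrite lt0n; apply: contraTneq mu_i => e; rewrite mu'0 //; apply: val_inj.
split; first lia.
by split=> /(congr1 val) /= e; apply: val_inj => /=; lia.
Qed.

Definition restrict (A : {set 'I_s}) mu : exps :=
  [ffun i => if i \in A then mu i else ord0].

Lemma support_restrict (A : {set 'I_s}) mu : support (restrict A mu) = A :&: support mu.
Proof. by apply/setP => i; rewrite !inE ffunE; case: (i \in A). Qed.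

Lemma sparse_dvd_restrict (A : {set 'I_s}) mu : sparse_dvd (restrict A mu) mu.
Proof. by apply/forall_inP => i; rewrite support_restrict ffunE => /setIP[->]. Qed.

Lemma le0_restrict mu nu :
  {in support nu, forall i, 0 < mu i <= nu i}%N -> le0 (restrict (support nu) mu) nu.
Proof.
move=> bnd; apply/le0P => i; rewrite ffunE; have := bnd i.
by case: ifPn => [nu_i /(_ isT)|]; rewrite ?inE -?leqNgt /=; lia.
Qed.

Definition var_rank i (v : nat) : nat := if v == 0%N then 0%N else (s * v + i)%N.

Lemma ltn_var_rank i : {homo var_rank i : v w / (v < w)%N}.
Proof.
move=> v w; rewrite /var_rank; have := ltn_ord i.
by do 2?[case: eqP => ?]; nia.
Qed.

Lemma leq_var_rank_val i k v w :
  (0 < w)%N -> (var_rank k w <= var_rank i v)%N -> (w <= v)%N.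
Proof.
rewrite /var_rank => w0; have := ltn_ord i.
by do 2?[case: eqP => ?]; nia.
Qed.

Lemma var_rank_neq i k v w : i != k -> (0 < v)%N -> var_rank i v != var_rank k w.
Proof.
rewrite /var_rank => ne_ik v0; case: (v =P 0%N) => [?|_]; first lia.
case: (w =P 0%N) => _; first by have := ltn_ord i; nia.
apply: contraNneq ne_ik => /(congr1 (modn^~ s)).
by rewrite ![(s * _)%N]mulnC !modnMDl !modn_small // => /val_inj ->.
Qed.

Definition weight mu : nat := (\sum_i var_rank i (mu i))%N.

Lemma leqif_weight mu nu :
  (forall i, mu i <= nu i)%N -> (weight mu <= weight nu ?= iff (mu == nu))%N.
Proof.
move=> le_mn; have -> : (mu == nu) = [forall i, mu i == nu i].
  by apply/eqP/eqfunP => /ffunP.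
apply: leqif_sum => i _; have rank_mono := leq_mono (@ltn_var_rank i).
by split; [rewrite rank_mono | rewrite eqn_leq !rank_mono -eqn_leq].
Qed.

Definition move_entry mu k i (v : 'I_b.+1) : exps :=
  [ffun j => if j == i then v else if j == k then ord0 else mu j].

Lemma weight_move_entry mu k i v : i \notin support mu :\ k ->
  (weight (move_entry mu k i v) + var_rank k (mu k) = weight mu + var_rank i v)%N.
Proof.
rewrite !inE negb_and negbK -leqNgt => free_i.
have -> : var_rank k (mu k) = (\sum_(j | j == k) var_rank j (mu j))%N.
  by rewrite big_pred1_eq.
have -> : var_rank i v = (\sum_(j | j == i) var_rank j v)%N by rewrite big_pred1_eq.
rewrite !(big_mkcond (pred1 _)) -!big_split; apply: eq_bigr => j _ /=.
rewrite ffunE; have [->|_] := eqVneq j i; last by case: eqP => _; rewrite addn0.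
by case: eqVneq free_i => [->|_] /=; [lia | rewrite leqn0 /var_rank => ->; lia].
Qed.

Definition minimal_tuples (L : {set exps}) : {set exps} :=
  [set mu in L | [forall tau in L, sparse_dvd tau mu ==> (tau == mu)]].

Lemma minimal_tuplesP (L : {set exps}) mu :
  reflect (mu \in L /\ {in L, forall tau, sparse_dvd tau mu -> tau = mu})
          (mu \in minimal_tuples L).
Proof.
rewrite inE; apply: (iffP andP) => -[Lmu min_mu]; split=> //.
  by move=> tau Lt; move/forall_inP/(_ tau Lt)/implyP: min_mu => dvd_mu /dvd_mu/eqP.
by apply/forall_inP => tau Lt; apply/implyP => /min_mu ->.
Qed.

Lemma minimal_tuples_below (L : {set exps}) mu :
  mu \in L -> exists2 tau, tau \in minimal_tuples L & sparse_dvd tau mu.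
Proof.
move=> Lmu; have [|tau /andP[Lt dvd_t] min_t] :=
    @arg_minnP _ mu [pred tau in L | sparse_dvd tau mu] weight.
  by rewrite inE Lmu; apply/forall_inP.
exists tau => //; apply/minimal_tuplesP; split=> // w Lw dvd_w.
have := min_t w; rewrite inE Lw (sparse_dvd_trans dvd_w dvd_t) => /(_ isT).
rewrite leqNgt (ltn_leqif (leqif_weight _)) ?negbK => [/eqP //|i].
exact: leq_sparse_dvd.
Qed.

(* Row [i] must be free in [mu] once the variable of row [k] is removed: either
   [i = k], or [mu] has no variable in row [i]. *)
Definition improves mu nu i k : bool :=
  [&& i \in support nu, k \in support mu, i \notin support mu :\ k &
      (var_rank i (nu i) < var_rank k (mu k))%N].

Definition improvable mu nu : bool := [exists i, exists k, improves mu nu i k].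

Lemma improves_neq mu nu i k : improves mu nu i k -> mu i != nu i.
Proof.
case/and4P; rewrite !inE negb_and negbK => nu_i mu_k.
case: eqVneq => [->|_ /= free_i _]; last by apply: contraNneq free_i => ->.
by move=> _; apply: contraTneq => ->; rewrite ltnn.
Qed.

Lemma ltn_weight_improves mu nu i k :
  improves mu nu i k -> (weight (move_entry mu k i (nu i)) < weight mu)%N.
Proof. by case/and4P=> _ _ /(weight_move_entry (nu i)); lia. Qed.

Lemma leq_unimprovable mu nu i k : ~~ improvable mu nu ->
    i \in support nu -> k \in support mu -> i \notin support mu :\ k ->
  (var_rank k (mu k) <= var_rank i (nu i))%N.
Proof.
move=> unimp nu_i mu_k free_i; rewrite leqNgt; apply: contra unimp => lt_ik.
by apply/existsP; exists i; apply/existsP; exists k; apply/and4P.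
Qed.

Lemma leq_unimprovable_val mu nu i : ~~ improvable mu nu ->
  i \in support mu -> i \in support nu -> (mu i <= nu i)%N.
Proof.
move=> unimp mu_i nu_i; apply: (@leq_var_rank_val i i); first by rewrite inE in mu_i.
by apply: leq_unimprovable; rewrite // !inE eqxx.
Qed.

Lemma unimprovable_move_entry mu nu k a : k \in support mu ->
  ~~ improvable mu nu -> ~~ improvable mu (move_entry nu a k (mu k)).
Proof.
move=> mu_k; apply: contra => /existsP[i /existsP[j /and4P[]]].
rewrite [i \in support _]inE ffunE => nu_i mu_j.
case: eqVneq nu_i => [-> _|_]; last first.
  case: eqP => // _ nu_i free_i lt_ij.
  apply/existsP; exists i; apply/existsP; exists j.
  by rewrite /improves inE nu_i mu_j free_i.
by rewrite inE mu_k andbT !inE negbK => /eqP ->; rewrite ltnn.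
Qed.

Section ShiftedSymmetric.

Variable L : {set exps}.
Hypothesis L_le0 : forall mu mu', mu \in L -> le0 mu' mu -> mu' \in L.
Hypothesis L_perm : forall (sigma : 'S_s) mu,
  mu \in L -> [ffun i => mu (sigma i)] \in L.

Lemma improves_move_entry mu nu i k :
  mu \in L -> improves mu nu i k -> move_entry mu k i (nu i) \in L.
Proof.
move=> Lmu /and4P[]; rewrite !inE negb_and negbK -leqNgt => nu_i mu_k free_i.
move/ltnW/(leq_var_rank_val nu_i) => le_ik.
apply: L_le0 (L_perm (tperm i k) Lmu) _; apply/le0P => j; rewrite !ffunE.
case: tpermP => [->|->|/eqP/negPf -> /eqP/negPf ->]; last lia.
  by rewrite eqxx; lia.
by rewrite [k == i]eq_sym eqxx; case: eqVneq free_i nu_i le_ik => [->|_] /=; lia.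
Qed.

(* [nu] may be lowered to the restriction of [mu] to its support, which divides
   [mu] and hence is [mu]. *)
Lemma minimal_support_sub mu nu :
    mu \in minimal_tuples L -> nu \in L -> ~~ improvable mu nu ->
  support nu \subset support mu -> support mu \subset support nu.
Proof.
move=> /minimal_tuplesP[_ min_mu] Lnu unimp /subsetP sub_nm.
have Lrestrict : restrict (support nu) mu \in L.
  apply: L_le0 Lnu (le0_restrict _) => i nu_i; have mu_i := sub_nm i nu_i.
  by rewrite leq_unimprovable_val // andbT; rewrite inE in mu_i.
by rewrite -(min_mu _ Lrestrict (sparse_dvd_restrict _ _)) support_restrict subsetIl.
Qed.

Lemma ltn_weight_unimprovable mu nu :
    mu \in minimal_tuples L -> nu \in L -> ~~ improvable mu nu -> nu != mu ->
  (weight mu < weight nu)%N.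
Proof.
move=> min_mu; have [d] := ubnP (weight nu); elim: d nu => // d IHd nu le_d.
move=> Lnu unimp ne_nu.
have [/subsetP sub_mn|not_sub] := boolP (support mu \subset support nu).
  rewrite (ltn_leqif (leqif_weight _)) ?[mu == nu]eq_sym // => i.
  have [mu_i|] := boolP (i \in support mu); last by rewrite inE -leqNgt; lia.
  by apply: leq_unimprovable_val => //; apply: sub_mn.
have /subsetPn[k mu_k nu_k] := not_sub.
have /subsetPn[a nu_a mu_a] : ~~ (support nu \subset support mu).
  by apply: contra not_sub; apply: minimal_support_sub.
have trade : improves nu mu k a.
  apply/and4P; split=> //; first by rewrite in_setD1 negb_and nu_k orbT.
  rewrite ltn_neqAle var_rank_neq.
  - by apply: leq_unimprovable => //; rewrite in_setD1 negb_and mu_a orbT.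
  - by apply: contraNneq mu_a => <-.
  - by rewrite inE in mu_k.
pose nu' := move_entry nu a k (mu k).
have lt_nu' : (weight nu' < weight nu)%N := ltn_weight_improves trade.
have [<- //|ne_nu'] := eqVneq nu' mu.
apply: (ltn_trans _ lt_nu'); apply: IHd => //; first exact: leq_trans lt_nu' _.
  exact: improves_move_entry.
exact: unimprovable_move_entry.
Qed.

Lemma minimal_tuples_exchange mu nu :
    mu \in minimal_tuples L -> nu \in minimal_tuples L -> nu != mu ->
    (weight nu <= weight mu)%N ->
  exists i k tau, [/\ tau \in minimal_tuples L, (weight tau < weight mu)%N,
    improves mu nu i k & sparse_dvd tau (move_entry mu k i (nu i))].
Proof.
move=> min_mu /minimal_tuplesP[Lnu _] ne_nu le_w.
have /existsP[i /existsP[k imp]] : improvable mu nu.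
  by apply: contraLR le_w => unimp; rewrite -ltnNge ltn_weight_unimprovable.
have [Lmu _] := minimal_tuplesP L mu min_mu.
have [tau min_tau dvd_tau] := minimal_tuples_below (improves_move_entry Lmu imp).
exists i, k, tau; split=> //; apply: leq_ltn_trans (ltn_weight_improves imp).
by apply: leqif_weight => j; apply: leq_sparse_dvd.
Qed.

End ShiftedSymmetric.

End SparseTuples.

Section SparseMonomials.

Variables (K : fieldType) (s b : nat).
Notation exps := {ffun 'I_s -> 'I_b.+1}.
Implicit Types (mu tau : exps).

Lemma mxvec_index_eq (i i' : 'I_s) (j j' : 'I_b) :
  (mxvec_index i j == mxvec_index i' j') = (i == i') && (j == j').
Proof. by rewrite (inj_eq (@cast_ord_inj _ _ _)) (inj_eq enum_rank_inj). Qed.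

Definition sparse_mnm mu : 'X_{1..s * b} :=
  (\sum_(i < s) if unlift ord0 (mu i) is Some j then U_(mxvec_index i j) else 0)%MM.

Lemma sparse_monomialE mu : sparse_monomial K mu = 'X_[sparse_mnm mu].
Proof.
rewrite -mprodXE; apply: eq_bigr => i _; rewrite /zvar0.
by case: unlift => //; rewrite mpolyX0.
Qed.

Lemma sparse_mnmE mu i j :
  sparse_mnm mu (mxvec_index i j) = (mu i == lift ord0 j).
Proof.
rewrite mnm_sumE (bigD1 i) //= big1 => [|i' /negPf ne_i]; last first.
  by case: unlift => [j'|]; rewrite ?mnm0E // mnm1E mxvec_index_eq ne_i.
rewrite addn0; case: unliftP => [j' ->|->]; last by rewrite mnm0E.
by rewrite mnm1E mxvec_index_eq eqxx (inj_eq lift_inj).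
Qed.

Lemma sparse_mnm_le tau mu : (sparse_mnm tau <= sparse_mnm mu)%MM = sparse_dvd tau mu.
Proof.
apply/mnm_lepP/forall_inP => [le_tm i|dvd_tm k].
  case/support_lift=> j e.
  by have := le_tm (mxvec_index i j); rewrite !sparse_mnmE e eqxx eq_sym lt0b.
case/mxvec_indexP: k => i j; rewrite !sparse_mnmE.
have [e|//] := eqVneq (tau i).
by have /eqP <- : tau i == mu i; [apply: dvd_tm; rewrite inE e | rewrite e eqxx].
Qed.

Lemma sparse_mnm_inj : injective sparse_mnm.
Proof.
move=> tau mu e; apply/ffunP => i; apply/val_inj/eqP.
by rewrite eqn_leq !leq_sparse_dvd // -sparse_mnm_le e lepm_refl.
Qed.

Lemma sparse_mnm_move_entry_le mu k i j :
  (sparse_mnm (move_entry mu k i (lift ord0 j))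
     <= sparse_mnm mu + U_(mxvec_index i j))%MM.
Proof.
apply/mnm_lepP => l; case/mxvec_indexP: l => i' j'.
rewrite mnmDE mnm1E mxvec_index_eq !sparse_mnmE ffunE [i' == i]eq_sym.
case: (i =P i') => _; first by rewrite (inj_eq lift_inj) leq_addl.
by rewrite addn0; case: (i' =P k).
Qed.

Lemma sym_act_sparse_monomial (sigma : 'S_s) mu :
  sym_act sigma (sparse_monomial K mu)
  = sparse_monomial K [ffun i => mu ((sigma^-1)%g i)].
Proof.
rewrite /sparse_monomial {1}/sym_act rmorph_prod /=.
rewrite [RHS](reindex_inj (@perm_inj _ sigma)) /=; apply: eq_bigr => i _.
rewrite ffunE permK /zvar0; case: unlift => [j|]; last by rewrite rmorph1.
exact: (@sym_act_zvar K).
Qed.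

End SparseMonomials.

Section SparseSymmetricShiftedIdeals.

Variables (K : fieldType) (s b : nat) (J : {mpoly K[s * b]} -> Prop).
Hypothesis sssJ : sparse_symmetric_shifted J.
Notation exps := {ffun 'I_s -> 'I_b.+1}.
Implicit Types (mu tau : exps).

Definition sparse_members : {set exps} := [set mu | `[< J (sparse_monomial K mu) >]].

Lemma sparse_membersP mu :
  reflect (J 'X_[sparse_mnm mu]) (mu \in sparse_members).
Proof. by rewrite inE -sparse_monomialE; apply: asboolP. Qed.

Lemma sss_is_monomial_ideal : is_monomial_ideal J.
Proof.
case: sssJ => _ [idJ [S [S_sqf genS]]] _ _ _; split=> //.
by exists S; split=> // u /S_sqf[m [_ ->]]; exists m.
Qed.

Lemma sss_mingens_sparse u : mingens J u -> exists mu, u = 'X_[sparse_mnm mu].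
Proof.
case: sssJ => _ _ [S [S_sparse genS]] _ _ min_u.
have [|mu ->] := S_sparse u (mingens_least _ genS min_u).
  by move=> v /S_sparse[mu ->]; exists (sparse_mnm mu); apply: sparse_monomialE.
by exists mu; apply: sparse_monomialE.
Qed.

Lemma sss_mingens_below m : J 'X_[m] ->
  exists2 mu, mingens J 'X_[sparse_mnm mu] & (sparse_mnm mu <= m)%MM.
Proof.
case/mingens_below=> m' min_m' le_m'; have [mu e] := sss_mingens_sparse min_m'.
by move: e min_m' le_m' => /mpolyX_inj ->; exists mu.
Qed.

(* (S-2) only concerns minimal generators: it is applied to a generator [tau]
   dividing [mu], with the entries of [tau] lowered to those of [mu']. *)
Lemma sss_le0 mu mu' : mu \in sparse_members -> le0 mu' mu -> mu' \in sparse_members.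
Proof.
move=> /sparse_membersP/sss_mingens_below[tau min_tau].
rewrite sparse_mnm_le => dvd_tau /le0P le_mu.
have Jrestrict : J 'X_[sparse_mnm (restrict (support tau) mu')].
  rewrite -sparse_monomialE; apply: (sss_S2 sssJ (mu := tau)).
    by rewrite sparse_monomialE.
  apply: le0_restrict => i tau_i; have := le_mu i.
  by have /eqP <- := forall_inP dvd_tau i tau_i; move: tau_i; rewrite inE; lia.
apply/sparse_membersP.
apply: is_ideal_mpolyX_le (proj1 sss_is_monomial_ideal) Jrestrict _.
by rewrite sparse_mnm_le sparse_dvd_restrict.
Qed.

Lemma sss_perm (sigma : 'S_s) mu :
  mu \in sparse_members -> [ffun i => mu (sigma i)] \in sparse_members.
Proof.
move=> /sparse_membersP; rewrite -sparse_monomialE => /(sss_S3 sssJ (sigma^-1)%g).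
by rewrite sym_act_sparse_monomial invgK sparse_monomialE => /sparse_membersP.
Qed.

Lemma sss_mingensP u :
  mingens J u <->
  exists2 mu, mu \in minimal_tuples sparse_members & u = 'X_[sparse_mnm mu].
Proof.
split=> [min_u|[mu /minimal_tuplesP[/sparse_membersP Jmu min_mu] ->]].
  have [mu e] := sss_mingens_sparse min_u; case: min_u => _; rewrite e => Jmu min_mu.
  exists mu => //; apply/minimal_tuplesP; split=> [|tau /sparse_membersP Jtau dvd_tau].
    exact/sparse_membersP.
  apply/sparse_mnm_inj/(@mpolyX_inj _ K)/min_mu => //; first by exists (sparse_mnm tau).
  by apply/divides_monomial; rewrite sparse_mnm_le.
have [tau min_tau le_tau] := sss_mingens_below Jmu.
suff <- : tau = mu by [].
by apply: min_mu; [apply/sparse_membersP; case: min_tau | rewrite -sparse_mnm_le].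
Qed.

End SparseSymmetricShiftedIdeals.

Theorem theorem2p6 (K : fieldType) (s b : nat) (hs : (1 <= s)%N) (hb : (1 <= b)%N)
    (J : {mpoly K[s * b]} -> Prop) (hJ : sparse_symmetric_shifted J) :
  has_linear_quotients J.
Proof.
apply: (@has_linear_quotients_weight _ _ _ _ (enum (minimal_tuples (sparse_members J)))
          (@sparse_mnm s b) (@weight s b)).
- exact: sss_is_monomial_ideal.
- exact: sparse_mnm_inj.
- exact: enum_uniq.
- move=> u; rewrite (sss_mingensP hJ).
  by split=> -[mu]; rewrite ?mem_enum; exists mu; rewrite ?mem_enum.
move=> mu nu; rewrite !mem_enum => min_mu min_nu ne_nu le_nu.
have [i [k [tau [min_tau lt_tau imp dvd_tau]]]] :=
  minimal_tuples_exchange (sss_le0 hJ) (sss_perm hJ) min_mu min_nu ne_nu le_nu.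
have [j nu_i] : exists j, nu i = lift ord0 j.
  by apply: support_lift; case/and4P: imp.
exists (mxvec_index i j), tau; split=> //; first by rewrite mem_enum.
  by rewrite !sparse_mnmE -nu_i eqxx (negPf (improves_neq imp)).
apply: lepm_trans (sparse_mnm_move_entry_le mu k i j).
by rewrite -nu_i sparse_mnm_le.
Qed.
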